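(* Let $X$ be a nonzero real Banach space. If a bounded linear operator $T\colon X\to X$ is a strong Daugavet operator, then $T$ satisfies the Daugavet equation $$\|\mathrm{Id}+T\|=1+\|T\|.$$
   Context: $S(X)$ denotes the unit sphere of $X$. For a bounded linear operator $T$ from $X$ into some Banach space and $\varepsilon>0$ put $U_{T,\varepsilon}=\{x\in X: \|Tx\|<\varepsilon\}$. The operator $T$ is called a strong Daugavet operator if for every $x,y\in S(X)$ and every $\varepsilon>0$ there is an element $z\in (y+U_{T,\varepsilon})\cap S(X)$ such that $\|z+x\|>2-\varepsilon$. *)

(* Defs.v *)
From mathcomp Require Import all_boot all_order all_algebra.
From mathcomp Require Import all_classical all_reals all_analysis.

Set Implicit Arguments.
Unset Strict Implicit.
Unset Printing Implicit Defensive.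

Import Order.TTheory GRing.Theory Num.Theory.
Import numFieldNormedType.Exports.

Local Open Scope classical_set_scope.
Local Open Scope ring_scope.

Definition unit_sphere (R : realType) (X : normedModType R) : set X :=
  [set x | `|x| = 1].
Arguments unit_sphere {R} X.

(* [sup] is a genuine supremum only for a set with an upper bound, i.e. for a
   bounded [T]; for an unbounded [T] the value is meaningless. *)
Definition opnorm (R : realType) (X Y : normedModType R)
    (T : {linear X -> Y}) : R :=
  sup [set `|T x| | x in [set x : X | `|x| <= 1]].

Definition operator_nbhs (R : realType) (X Y : normedModType R)
    (T : {linear X -> Y}) (e : R) : set X :=
  [set x | `|T x| < e].

Definition strong_Daugavet (R : realType) (X Y : completeNormedModType R)
    (T : {linear X -> Y}) : Prop :=
  forall x y : X, unit_sphere X x -> unit_sphere X y ->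
  forall e : R, 0 < e ->
  exists z : X,
    ([set y + u | u in operator_nbhs T e] `&` unit_sphere X) z /\
    2 - e < `|z + x|.

(* Main.v *)
Require Import Defs.
From mathcomp Require Import all_boot all_order all_algebra.
From mathcomp Require Import all_classical all_reals all_analysis.
From mathcomp Require Import lra.

(** The inequality [||Id + T|| <= 1 + ||T||] is the triangle inequality. For
    the converse it is enough to show [1 + |T y| <= ||Id + T||] for every unit
    vector [y], because [||T||] is the supremum of [|T y|] over the unit
    sphere, which is nonempty as [X] is not zero. Suppose [T y != 0] and apply the strong Daugavet property to [y]
    and to the direction [x] of [T y]: it yields a unit vector [z] with [T z]
    close to [T y = |T y| *: x] and [|z + x|] close to 2. Then [z] and [x] are
    almost aligned, so that [|z + l *: x|] is close to [1 + l] for every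
    [l >= 0] ([norm_addZ_ge]). With [l = |T y|], the norm of
    [z + T z] is close to [1 + |T y|]. *)

Import Order.TTheory GRing.Theory Num.Theory.
Import numFieldNormedType.Exports.

Local Open Scope classical_set_scope.
Local Open Scope ring_scope.

(** Almost alignment of two vectors of the unit ball survives rescaling one of
    them: if [|z + x|] is close to 2 then [|z + l *: x|] is close to [1 + l].
    Indeed [(1 + l) *: (z + x)] is the sum of [z + l *: x] and
    [l *: z + x], and the latter has norm at most [1 + l]. *)
Lemma norm_addZ_ge (R : realType) (X : normedModType R) (x z : X) (l : R) :
  0 <= l -> `|x| <= 1 -> `|z| <= 1 ->
  (1 + l) * (`|z + x| - 1) <= `|z + l *: x|.
Proof.
move=> l0 x1 z1.
have E : (1 + l) *: (z + x) = (z + l *: x) + (l *: z + x).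
  by rewrite scalerDl scale1r scalerDr addrACA [x + _]addrC addrACA.
have : `|(1 + l) *: (z + x)| <= `|z + l *: x| + `|l *: z + x|.
  by rewrite E ler_normD.
have : `|l *: z + x| <= l * `|z| + `|x|.
  by rewrite (le_trans (ler_normD _ _))// normrZ ger0_norm.
have : l * `|z| <= l by rewrite ler_piMr.
rewrite normrZ ger0_norm ?addr_ge0//; lra.
Qed.

Lemma le_opnorm (R : realType) (X Y : normedModType R) (T : {linear X -> Y})
    (x : X) :
  bounded_fun_norm T -> `|x| <= 1 -> `|T x| <= opnorm T.
Proof.
move=> Tb x1; apply: ub_le_sup; last by exists x.
by have [M TM] := Tb 1; exists M => _ [y /= y1 <-]; exact: TM.
Qed.

Lemma opnorm_le (R : realType) (X Y : normedModType R) (T : {linear X -> Y})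
    (M : R) :
  (forall x, `|x| <= 1 -> `|T x| <= M) -> opnorm T <= M.
Proof.
move=> TM; apply: ge_sup; last by move=> _ [y /= y1 <-]; exact: TM.
by exists `|T 0|, 0 => //=; rewrite normr0.
Qed.

(** Homogeneity carries the bound from the sphere to the rest of the ball. The
    condition [0 <= M] takes care of the vector 0, hence also of the zero
    space, whose unit sphere is empty. *)
Lemma opnorm_le_sphere (R : realType) (X Y : normedModType R)
    (T : {linear X -> Y}) (M : R) :
  0 <= M -> (forall x, `|x| = 1 -> `|T x| <= M) -> opnorm T <= M.
Proof.
move=> M0 TM; apply: opnorm_le => x x1.
have [->|x0] := eqVneq x 0; first by rewrite linear0 normr0.
have nx : 0 < `|x| by rewrite normr_gt0.
have := TM (`|x|^-1 *: x).
rewrite linearZ/= !normrZ normfV normr_id mulVf ?gt_eqF// => /(_ erefl).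
rewrite ler_pdivrMl// => /le_trans; apply; exact: ler_piMl.
Qed.

Lemma bounded_idD (R : realType) (X : normedModType R) (T : {linear X -> X}) :
  bounded_fun_norm T -> bounded_fun_norm (idfun \+ T).
Proof.
move=> Tb r; have [M TM] := Tb r; exists (r + M) => x xr /=.
by rewrite (le_trans (ler_normD _ _))// lerD// TM.
Qed.

(** The lower bound behind the Daugavet equation. When [T y = 0] the vector
    [y] itself is a witness; otherwise the strong Daugavet property, with
    [x] the direction of [T y], provides one up to an arbitrary error. *)
Lemma strong_Daugavet_le_opnorm_idD (R : realType) (X : completeNormedModType R)
    (T : {linear X -> X}) (y : X) :
  bounded_fun_norm T -> strong_Daugavet T -> `|y| = 1 ->
  1 + `|T y| <= opnorm (idfun \+ T).
Proof.
move=> Tb DT y1; have idTb := bounded_idD _ _ _ Tb.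
have [Ty0|Ty0] := eqVneq (T y) 0.
  have := @le_opnorm _ _ _ (idfun \+ T) y idTb.
  by rewrite /= Ty0 addr0 normr0 addr0 y1; apply.
have l_gt0 : 0 < `|T y| by rewrite normr_gt0.
set l := `|T y| in l_gt0 *; pose x := l^-1 *: T y.
have x1 : `|x| = 1 by rewrite normrZ normfV normr_id mulVf ?gt_eqF.
have Ty : T y = l *: x by rewrite scalerA mulfV ?gt_eqF// scale1r.
apply/ler_addgt0Pr => d d0.
(* The total error is [e] from replacing [T z] by [T y] and [(1 + l) * e]
   from the rescaling of [x]. *)
pose e := d / (2 + l).
have e0 : 0 < e by rewrite divr_gt0// addr_gt0.
have de : d = (2 + l) * e by rewrite mulrC divfK// gt_eqF// addr_gt0.
have [_ [[[u Tu <-] z1] zx]] := DT x y x1 y1 e e0.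
move: Tu z1 zx; rewrite /operator_nbhs /unit_sphere/=.
set z := y + u => Tu z1 zx.
have zTz : z + T z = (z + l *: x) + T u by rewrite /z linearD -Ty addrA.
have := @le_opnorm _ _ _ (idfun \+ T) z idTb; rewrite z1 lexx => /(_ isT)/=.
have := lerB_normD (z + l *: x) (T u); rewrite -zTz.
have := @norm_addZ_ge _ _ x z l (ltW l_gt0).
rewrite x1 z1 lexx => /(_ isT isT).
have : (1 + l) * (1 - e) <= (1 + l) * (`|z + x| - 1).
  rewrite ler_wpM2l ?addr_ge0 ?(ltW l_gt0)//; lra.
rewrite de; lra.
Qed.

Theorem lemma3p2 (R : realType) (X : completeNormedModType R)
    (X_neq0 : exists x : X, x != 0)
    (T : {linear X -> X}) (T_bounded : bounded_fun_norm T) :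
  strong_Daugavet T -> opnorm (idfun \+ T) = 1 + opnorm T.
Proof.
move=> DT; apply/eqP; rewrite eq_le; apply/andP; split.
  apply: opnorm_le => x x1 /=.
  by rewrite (le_trans (ler_normD _ _))// lerD// le_opnorm.
have idT_ge y := @strong_Daugavet_le_opnorm_idD _ _ _ y T_bounded DT.
rewrite addrC -lerBrDr; apply: opnorm_le_sphere => [|y /idT_ge]; last first.
  by rewrite lerBrDr addrC.
have [x x0] := X_neq0.
have /idT_ge : `|(`|x|^-1 *: x)| = 1.
  by rewrite normrZ normfV normr_id mulVf// normr_eq0.
by rewrite subr_ge0; apply: le_trans; rewrite lerDl.
Qed.
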